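(* Let $M$ be a smooth $n$-dimensional manifold, let $\mathcal{J}$ be an adapted almost tangent structure on $T^{*}M\setminus\{0\}$, let $\rho$ be a $\mathcal{J}$-regular vector field, and let $\mathcal{N}$ be a nonlinear connection with horizontal and vertical projectors $h,v$. Let $\mathbb{F}=h\circ\mathcal{L}_\rho h-\mathcal{J}$ and let $\mathcal{D}$ be the Berwald linear connection $$\mathcal{D}_XY=v[hX,vY]+h[vX,hY]+\mathcal{J}[vX,(\mathbb{F}+\mathcal{J})Y]+(\mathbb{F}+\mathcal{J})[hX,\mathcal{J}Y].$$ Then $$\mathcal{D}h=0,\quad \mathcal{D}v=0,\quad \mathcal{D}\mathcal{J}=0,\quad \mathcal{D}\mathbb{F}=0.$$
   Context: All structures are smooth on $T^{*}M\setminus\{0\}$ (the cotangent bundle with the zero section removed), with induced local coordinates $(x^i,p_i)$; $\mathcal{X}(\cdot)$ denotes vector fields. The vertical distribution $VT^{*}M$ is spanned locally by $\partial/\partial p_i$. Nonlinear connection: a $(1,1)$-tensor field $\mathcal{N}$ with $\mathcal{N}^2=\mathrm{Id}$ and $\ker(\mathrm{Id}+\mathcal{N})=VT^{*}M$; its projectors are $h=\frac12(\mathrm{Id}+\mathcal{N})$ and $v=\frac12(\mathrm{Id}-\mathcal{N})$. Adapted almost tangent structure: a $(1,1)$-tensor field $\mathcal{J}$ of rank $n$ with $\mathcal{J}^2=0$ and $\operatorname{Im}\mathcal{J}=\ker\mathcal{J}=VT^{*}M$; locally $\mathcal{J}=t_{ij}\,dx^i\otimes\frac{\partial}{\partial p_j}$,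 meaning $\mathcal{J}(\partial/\partial x^i)=t_{ij}\,\partial/\partial p_j$ and $\mathcal{J}(\partial/\partial p_i)=0$. A vector field $\rho$ is $\mathcal{J}$-regular if $\mathcal{J}[\rho,\mathcal{J}X]=-\mathcal{J}X$ for all vector fields $X$. For a $(1,1)$-tensor field $L$, $(\mathcal{L}_\rho L)(X)=[\rho,LX]-L[\rho,X]$. For a $(1,1)$-tensor field $T$, $\mathcal{D}T=0$ means $\mathcal{D}_X(TY)=T(\mathcal{D}_XY)$ for all vector fields $X,Y$ on $T^{*}M\setminus\{0\}$. *)

(* Defs.v *)
From HB Require Import structures.
From mathcomp Require Import all_boot all_order all_algebra.
From mathcomp Require Import all_classical all_reals all_analysis.
From mathcomp Require Import ring.
Set Implicit Arguments.
Unset Strict Implicit.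
Unset Printing Implicit Defensive.
Import Order.TTheory GRing.Theory Num.Theory numFieldNormedType.Exports.
Local Open Scope classical_set_scope.
Local Open Scope ring_scope.

Section Smooth.
Context {R : realType} {m : nat}.
Implicit Types (U : set 'rV[R]_m) (f g : 'rV[R]_m -> R).

Definition partial (i : 'I_m) f : 'rV[R]_m -> R :=
  fun x => 'D_(delta_mx 0 i) f x.

(* f is of class C^k on the open set U. *)
Fixpoint Ck (k : nat) U f : Prop :=
  (forall x, U x -> {for x, continuous f}) /\
  if k is k'.+1 then
    forall i : 'I_m, (forall x, U x -> derivable f x (delta_mx 0 i)) /\
                     Ck k' U (partial i f)
  else True.

Definition smooth_on U f : Prop := forall k, Ck k U f.

Lemma Ck_cont k U f : Ck k U f -> forall x, U x -> {for x, continuous f}.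
Proof. by case: k => [|k] []. Qed.

Lemma eq_near U f g : open U -> (forall x, U x -> f x = g x) ->
  forall x, U x -> {near x, f =1 g}.
Proof.
move=> oU fg x Ux; near=> y; apply: fg; near: y; exact: open_nbhs_nbhs.
Unshelve. all: by end_near. Qed.

Lemma Ck_ext k U f g : open U -> (forall x, U x -> f x = g x) ->
  Ck k U f -> Ck k U g.
Proof.
move=> oU; elim: k f g => [|k IH] f g fg /= [cf H];
  (split; first by move=> x Ux; have e := eq_near oU fg Ux;
    rewrite /prop_for /continuous_at -(fg _ Ux); apply: cvg_trans (cf _ Ux);
    exact: near_eq_cvg e) => //.
move=> i; case: (H i) => df ck; split.
  move=> x Ux; apply: near_eq_derivable (df _ Ux); exact: eq_near oU fg _ Ux.
apply: IH ck => x Ux; apply: near_eq_derive; exact: eq_near oU fg _ Ux.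
Qed.

Lemma CkS k U f : Ck k.+1 U f -> Ck k U f.
Proof.
elim: k f => [|k IH] f [cf H]; split => // i.
by case: (H i) => df ck; split => //; apply: IH.
Qed.

Lemma Ck_cst k U (c : R) : Ck k U (fun=> c).
Proof.
elim: k c => [|k IH] c; (split; first by move=> x _; exact: cst_continuous) => //.
move=> i; split; first by move=> x _; exact: derivable_cst.
rewrite (_ : partial i _ = (fun=> 0)); first exact: IH.
by apply/funext => x; rewrite /partial derive_cst.
Qed.

Lemma Ck_add k U f g : open U -> Ck k U f -> Ck k U g -> Ck k U (f + g).
Proof.
move=> oU; elim: k f g => [|k IH] f g [cf Hf] [cg Hg].
  by split => // x Ux; exact: cvgD (cf x Ux) (cg x Ux).
split; first by move=> x Ux; exact: cvgD (cf x Ux) (cg x Ux).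
move=> i; case: (Hf i) (Hg i) => df ckf [dg ckg]; split.
  by move=> x Ux; apply: derivableD; [exact: df|exact: dg].
apply: (@Ck_ext _ _ (partial i f + partial i g)) => //; last exact: IH.
by move=> x Ux; rewrite /partial deriveD //; [exact: df|exact: dg].
Qed.

Lemma Ck_mul k U f g : open U -> Ck k U f -> Ck k U g -> Ck k U (f * g).
Proof.
move=> oU; elim: k f g => [|k IH] f g Cf Cg.
  split => // x Ux.
  exact: cvgM (Ck_cont Cf Ux) (Ck_cont Cg Ux).
split.
  move=> x Ux.
  exact: cvgM (Ck_cont Cf Ux) (Ck_cont Cg Ux).
move=> i; have := CkS Cf; have := CkS Cg.
case: Cf Cg => _ /(_ i)[df ckf] [_ /(_ i)[dg ckg]] Cg Cf; split.
  by move=> x Ux; apply: derivableM; [exact: df|exact: dg].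
apply: (@Ck_ext _ _ (f * partial i g + g * partial i f)) => //.
  by move=> x Ux; rewrite /partial deriveM //; [exact: df|exact: dg].
by apply: Ck_add => //; apply: IH.
Qed.

Lemma smooth_sum U (I : Type) (r : seq I) (F : I -> 'rV[R]_m -> R) : open U ->
  (forall i, smooth_on U (F i)) -> smooth_on U (fun x => \sum_(i <- r) F i x).
Proof.
move=> oU sF k; elim: r => [|i r IH].
  rewrite (_ : (fun x => _) = (fun=> 0)); first exact: Ck_cst.
  by apply/funext => x; rewrite big_nil.
rewrite (_ : (fun x => _) = F i + (fun x => \sum_(i <- r) F i x)).
  by apply: Ck_add => //; exact: sF.
by apply/funext => x; rewrite big_cons.
Qed.

End Smooth.

(* Charts are total functions: [chart a] is only meaningful on [chart_dom a],
   and [chart_inv a] on the image of [chart_dom a]. *)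
Record manifold (R : realType) (n : nat) := Manifold {
  mspace :> topologicalType;
  manifold_hausdorff : hausdorff_space mspace;
  manifold_second_countable : @second_countable mspace;
  atlas : Type;
  chart_dom : atlas -> set mspace;
  chart : atlas -> mspace -> 'rV[R]_n;
  chart_inv : atlas -> 'rV[R]_n -> mspace;
  chart_dom_open : forall a, open (chart_dom a);
  chart_cover : forall q, exists a, chart_dom a q;
  chart_img_open : forall a, open (chart a @` chart_dom a);
  chartK : forall a q, chart_dom a q -> chart_inv a (chart a q) = q;
  chart_cont : forall a q, chart_dom a q -> {for q, continuous (chart a)};
  chart_inv_cont : forall a x, (chart a @` chart_dom a) x ->
    {for x, continuous (chart_inv a)};
  chart_transition : forall a b (i : 'I_n),
    smooth_on (chart a @` (chart_dom a `&` chart_dom b))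
              (fun x => chart b (chart_inv a x) 0 i)
}.
Arguments chart_img_open {R n m} a.
Arguments chart_dom {R n m} a _.
Arguments chart {R n m} a _.
Arguments chart_inv {R n m} a _.

Section Cotangent.
Context {R : realType} {n : nat}.
Variable M : manifold R n.

Definition smooth_near (q : M) (f : M -> R) : Prop :=
  exists W : set M, [/\ open W, W q & forall a : atlas M,
    smooth_on (chart a @` (chart_dom a `&` W)) (f \o chart_inv a)].

(* The covector df_q, given by its components (df/dx^i)(q) in every chart
   around q, and by 0 in the charts whose domain does not contain q. *)
Definition differential (q : M) (f : M -> R) : atlas M -> 'rV[R]_n := fun a =>
  if `[< chart_dom a q >]
  then \row_i partial i (f \o chart_inv a) (chart a q) else 0.

(* T*_q M is the set of the df_q for f smooth near q. *)
Definition cotangent (q : M) : set (atlas M -> 'rV[R]_n) :=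
  [set alpha | exists2 f, smooth_near q f & alpha = differential q f].

(* T*M \ {0}, used below as a type. *)
Definition slit_cotangent : set (M * (atlas M -> 'rV[R]_n)) :=
  [set e | cotangent e.1 e.2 /\ e.2 != 0].

Definition base (e : slit_cotangent) : M := (val e).1.

(* Induced coordinates (x^i, p_i), for base e in chart_dom a. *)
Definition ind_chart (a : atlas M) (e : slit_cotangent) : 'rV[R]_(n + n) :=
  row_mx (chart a (base e)) ((val e).2 a).

Definition ind_chart_img (a : atlas M) : set 'rV[R]_(n + n) :=
  [set y | (chart a @` chart_dom a) (lsubmx y) /\ rsubmx y != 0].

(* (x, p) is sent to the point q of coordinates x and the covector
   p_i dx^i at q. *)
Definition ind_chart_inv (a : atlas M) (y : 'rV[R]_(n + n)) :
    M * (atlas M -> 'rV[R]_n) :=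
  let q := chart_inv a (lsubmx y) in
  (q, differential q (fun q' => \sum_(i < n) rsubmx y 0 i * chart a q' 0 i)).

(* The expression of f in the induced coordinates, only meaningful on
   ind_chart_img a. *)
Definition local_expr (a : atlas M) (f : slit_cotangent -> R) :
    'rV[R]_(n + n) -> R :=
  fun y => oapp f 0 (insub (ind_chart_inv a y)).

Definition is_smooth : {pred slit_cotangent -> R} := fun f =>
  `[< forall a, smooth_on (ind_chart_img a) (local_expr a f) >].

Lemma overlap_open (a b : atlas M) :
  open (chart a @` (chart_dom a `&` chart_dom b)).
Proof.
rewrite openE => _ [q [aq bq] <-].
have ia : (chart a @` chart_dom a) (chart a q) by exists q.
have H1 : nbhs (chart a q) (chart a @` chart_dom a).
  by apply: open_nbhs_nbhs; split => //; exact: chart_img_open.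
have H2 : nbhs (chart a q) (chart_inv a @^-1` chart_dom b).
  apply: (chart_inv_cont ia); rewrite chartK //.
  by apply: open_nbhs_nbhs; split => //; exact: chart_dom_open.
apply: filterS2 H1 H2 => y [r ar <-] /=; rewrite chartK // => br.
by exists r.
Qed.

Lemma linear_smooth_near (a : atlas M) (q : M) (p : 'rV[R]_n) :
  chart_dom a q ->
  smooth_near q (fun q' => \sum_(i < n) p 0 i * chart a q' 0 i).
Proof.
move=> aq; exists (chart_dom a); split => //; first exact: chart_dom_open.
move=> b; apply: smooth_sum; first exact: overlap_open.
move=> i k; apply: (@Ck_mul _ _ _ _ (fun=> p 0 i)
  (fun x => chart a (chart_inv b x) 0 i)); first exact: overlap_open.
  exact: Ck_cst.
exact: chart_transition.
Qed.

Lemma partial_linear (p x : 'rV[R]_n) (i : 'I_n) :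
  partial i (fun x : 'rV[R]_n => \sum_(j < n) p 0 j * x 0 j) x = p 0 i.
Proof.
rewrite /partial; apply: cvg_lim => //.
apply: cvg_near_cst.
near=> h; have h0 : h != 0 by near: h; exact: nbhs_dnbhs_neq.
rewrite /= -sumrB (bigD1 i) //= big1 => [|j ji]; rewrite !mxE eqxx /=.
  rewrite eqxx addr0 mulr1 -mulrBr addrK.
  by rewrite /GRing.scale /= mulrCA mulVf // mulr1.
by rewrite (negbTE ji) mulr0 add0r subrr.
Unshelve. all: by end_near. Qed.

Lemma differential_linear (a : atlas M) (q : M) (p : 'rV[R]_n) :
  chart_dom a q ->
  differential q (fun q' => \sum_(i < n) p 0 i * chart a q' 0 i) a = p.
Proof.
move=> aq; rewrite /differential asboolT //; apply/rowP => i; rewrite mxE.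
rewrite -[RHS](partial_linear p (chart a q)); apply: near_eq_derive.
have lin x : (chart a @` chart_dom a) x ->
    ((fun q' => \sum_(i < n) p 0 i * chart a q' 0 i) \o chart_inv a) x =
    \sum_(i < n) p 0 i * x 0 i.
  by case=> r ar <- /=; rewrite chartK.
by apply: (eq_near (chart_img_open a) lin); exists q.
Qed.

Lemma ind_chart_invP (a : atlas M) (y : 'rV[R]_(n + n)) :
  ind_chart_img a y -> slit_cotangent (ind_chart_inv a y).
Proof.
case=> -[q aq qy] p0; split; rewrite /ind_chart_inv /= -qy chartK //.
  exists (fun q' => \sum_(i < n) rsubmx y 0 i * chart a q' 0 i) => //.
  exact: linear_smooth_near aq.
apply: contra_neq p0 => /(congr1 (@^~ a)).
by rewrite differential_linear.
Qed.

Lemma ind_chart_img_open (a : atlas M) : open (ind_chart_img a).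
Proof.
apply: openI.
  have /continuousP := @continuous_lsubmx R 1 n n.
  by move=> /(_ _ (chart_img_open a)).
have /continuousP := @continuous_rsubmx R 1 n n.
move=> /(_ [set p | p != 0]); apply.
rewrite (_ : [set p | _] = ~` [set 0]); last by apply/seteqP; split => p /= /eqP.
rewrite openC; apply: accessible_closed_set1.
exact: hausdorff_accessible (@norm_hausdorff _ _).
Qed.

Lemma local_exprD a (f g : slit_cotangent -> R) :
  local_expr a (f + g) = local_expr a f + local_expr a g.
Proof.
apply/funext => y; rewrite /local_expr /GRing.add /=.
by case: insub => //=; rewrite addr0.
Qed.

Lemma local_exprM a (f g : slit_cotangent -> R) :
  local_expr a (f * g) = local_expr a f * local_expr a g.
Proof.
apply/funext => y; rewrite /local_expr /GRing.mul /=.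
by case: insub => //=; rewrite mulr0.
Qed.

Lemma local_expr_cst a (c : R) (y : 'rV[R]_(n + n)) :
  ind_chart_img a y -> local_expr a (fun=> c) y = c.
Proof.
move=> /ind_chart_invP ay; rewrite /local_expr.
by case: insubP => //= /negP[]; exact/mem_set.
Qed.

Lemma is_smooth_cst (c : R) : (fun=> c) \in is_smooth.
Proof.
apply/asboolP => a k.
apply: (@Ck_ext _ _ k _ (fun=> c) _ (@ind_chart_img_open a)); last exact: Ck_cst.
by move=> y ay; rewrite local_expr_cst.
Qed.

Lemma is_smoothD (f g : slit_cotangent -> R) :
  f \in is_smooth -> g \in is_smooth -> f + g \in is_smooth.
Proof.
move=> /asboolP sf /asboolP sg; apply/asboolP => a k; rewrite local_exprD.
by apply: Ck_add; [exact: ind_chart_img_open|exact: sf|exact: sg].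
Qed.

Lemma is_smoothM (f g : slit_cotangent -> R) :
  f \in is_smooth -> g \in is_smooth -> f * g \in is_smooth.
Proof.
move=> /asboolP sf /asboolP sg; apply/asboolP => a k; rewrite local_exprM.
by apply: Ck_mul; [exact: ind_chart_img_open|exact: sf|exact: sg].
Qed.

Lemma is_smoothZ (c : R) (f : slit_cotangent -> R) :
  f \in is_smooth -> c *: f \in is_smooth.
Proof. by move=> sf; apply: (is_smoothM (is_smooth_cst c) sf). Qed.

Lemma is_smooth_subring : subring_closed is_smooth.
Proof.
split; first exact: is_smooth_cst.
  move=> f g sf sg; apply: is_smoothD => //.
  by rewrite -scaleN1r; exact: is_smoothZ.
exact: is_smoothM.
Qed.

HB.instance Definition _ := GRing.isSubringClosed.Build _ is_smooth
  is_smooth_subring.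
HB.instance Definition _ := GRing.isScaleClosed.Build _ _ is_smooth is_smoothZ.

Record smooth_fun := SmoothFun {
  sfun :> slit_cotangent -> R;
  sfunP : sfun \in is_smooth }.

HB.instance Definition _ := [isSub for sfun].
HB.instance Definition _ := [Choice of smooth_fun by <:].
HB.instance Definition _ := 
  GRing.SubChoice_isSubComPzRing.Build _ _ smooth_fun is_smooth_subring.
HB.instance Definition _ := [SubNmodule_isSubLSemiModule of smooth_fun by <:].

(* X(T*M \ {0}): the vector fields on T*M \ {0}, identified with the
   R-linear derivations of its ring of smooth functions. *)
Definition derivation : {pred smooth_fun -> smooth_fun} := fun X =>
  `[< (forall (c : R) f g, X (c *: f + g) = c *: X f + X g) /\
      (forall f g, X (f * g) = X f * g + f * X g) >].

Lemma scale_mulE (c : R) (f g : smooth_fun) : (c *: f) * g = c *: (f * g).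
Proof. by apply/val_inj/funext => e; exact: esym (mulrA c (f e) (g e)). Qed.

Lemma derivation_zmod : zmod_closed derivation.
Proof.
split.
  by apply/asboolP; split=> [c f g|f g] /=; rewrite ?scaler0 ?mul0r ?mulr0 addr0.
move=> X Y /asboolP[linX derX] /asboolP[linY derY]; apply/asboolP.
have E h : (X - Y) h = X h - Y h by [].
split=> [c f g|f g]; rewrite !E.
  by rewrite linX linY scalerBr opprD addrACA.
rewrite derX derY; ring.
Qed.

HB.instance Definition _ := GRing.isZmodClosed.Build _ derivation
  derivation_zmod.

Record vfield := VField {
  vact :> smooth_fun -> smooth_fun;
  vactP : vact \in derivation }.

HB.instance Definition _ := [isSub for vact].
HB.instance Definition _ := [Choice of vfield by <:].
HB.instance Definition _ := [SubChoice_isSubZmodule of vfield by <:].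

Lemma vscale_subproof (g : smooth_fun) (X : vfield) :
  (fun f => g * X f) \in derivation.
Proof.
case: X => [X /= /asboolP[linX derX]]; apply/asboolP; split=> [c f k|f k].
  by rewrite linX mulrDr; congr (_ + _); rewrite mulrC scale_mulE mulrC.
rewrite derX; ring.
Qed.

Definition vscale (g : smooth_fun) (X : vfield) : vfield :=
  VField (vscale_subproof g X).

Fact vscaleA g h X : vscale g (vscale h X) = vscale (g * h) X.
Proof. by apply/val_inj/funext => f; exact: mulrA. Qed.

Fact vscale1 : left_id 1 vscale.
Proof. by move=> X; apply/val_inj/funext => f; exact: mul1r. Qed.

Fact vscaleDr : right_distributive vscale +%R.
Proof. by move=> g X Y; apply/val_inj/funext => f; exact: mulrDr. Qed.

Fact vscaleDl X : {morph vscale^~ X : g h / g + h}.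
Proof. by move=> g h; apply/val_inj/funext => f; exact: mulrDl. Qed.

HB.instance Definition _ := GRing.Zmodule_isLmodule.Build smooth_fun vfield
  vscaleA vscale1 vscaleDr vscaleDl.

Lemma lie_subproof (X Y : vfield) :
  (fun f => X (Y f) - Y (X f)) \in derivation.
Proof.
case: X Y => [X /= /asboolP[linX derX]] [Y /= /asboolP[linY derY]].
apply/asboolP; split=> [c f g|f g].
  by rewrite linY !linX linY scalerBr opprD addrACA.
have addX h k : X (h + k) = X h + X k by rewrite -[h]scale1r linX !scale1r.
have addY h k : Y (h + k) = Y h + Y k by rewrite -[h]scale1r linY !scale1r.
rewrite derX derY addX addY !derX !derY; ring.
Qed.

Definition lie (X Y : vfield) : vfield := VField (lie_subproof X Y).

(* A (1,1)-tensor field, identified with the corresponding endomorphism of the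
   module of vector fields over the ring of smooth functions. *)
Definition tensor11 := {linear vfield -> vfield}.

(* The value of X at e, as a derivation at e. *)
Definition tval (X : vfield) (e : slit_cotangent) : smooth_fun -> R :=
  fun f => X f e.

(* The coordinate vector d/dp_i at e, for base e in chart_dom a. *)
Definition ddp (a : atlas M) (e : slit_cotangent) (i : 'I_n) : smooth_fun -> R :=
  fun f => partial (rshift n i) (local_expr a f) (ind_chart a e).

Definition vertical_at (X : vfield) (e : slit_cotangent) : Prop :=
  forall a, chart_dom a (base e) ->
    exists c : 'I_n -> R, tval X e = \sum_i c i *: ddp a e i.

(* Every tangent vector at e is the value at e of some vector field; the next
   three definitions are thus pointwise conditions on the endomorphism L_e of
   the tangent space at e, namely Ker L_e = V_e, Im L_e = V_e, rank L_e = r. *)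
Definition kernel_is_vertical (L : vfield -> vfield) : Prop :=
  forall X e, tval (L X) e = 0 <-> vertical_at X e.

Definition image_is_vertical (L : vfield -> vfield) : Prop :=
  forall X e, vertical_at X e <-> exists Y, tval X e = tval (L Y) e.

Definition has_rank (L : vfield -> vfield) (r : nat) : Prop :=
  forall e, exists X : 'I_r -> vfield,
    (forall c : 'I_r -> R,
       \sum_i c i *: tval (L (X i)) e = 0 -> forall i, c i = 0) /\
    (forall Y, exists c : 'I_r -> R,
       tval (L Y) e = \sum_i c i *: tval (L (X i)) e).

Definition adapted_almost_tangent (J : tensor11) : Prop :=
  [/\ has_rank J n, (forall X, J (J X) = 0),
      image_is_vertical J & kernel_is_vertical J].

Definition regular_vfield (J : tensor11) (rho : vfield) : Prop :=
  forall X, J (lie rho (J X)) = - J X.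

Definition nonlinear_connection (N : tensor11) : Prop :=
  (forall X, N (N X) = X) /\ kernel_is_vertical (fun X => X + N X).

Definition one_half : smooth_fun := (2^-1 : R) *: (1 : smooth_fun).

Definition hproj (N : tensor11) : vfield -> vfield :=
  fun X => one_half *: (X + N X).

Definition vproj (N : tensor11) : vfield -> vfield :=
  fun X => one_half *: (X - N X).

Definition lie_tensor (rho : vfield) (L : vfield -> vfield) : vfield -> vfield :=
  fun X => lie rho (L X) - L (lie rho X).

Definition FF (J : tensor11) (rho : vfield) (N : tensor11) : vfield -> vfield :=
  fun X => hproj N (lie_tensor rho (hproj N) X) - J X.

Definition berwald (J : tensor11) (rho : vfield) (N : tensor11)
    (X Y : vfield) : vfield :=
  let h := hproj N in let v := vproj N in
  let FJ Z := FF J rho N Z + J Z in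
  v (lie (h X) (v Y)) + h (lie (v X) (h Y))
  + J (lie (v X) (FJ Y)) + FJ (lie (h X) (J Y)).

Definition parallel (D : vfield -> vfield -> vfield) (T : vfield -> vfield) :
    Prop :=
  forall X Y, D X (T Y) = T (D X Y).

End Cotangent.

(* Main.v *)
Require Import Defs.
From HB Require Import structures.
From mathcomp Require Import all_boot all_order all_algebra.
From mathcomp Require Import all_classical all_reals all_analysis.
From mathcomp Require Import ring.
Set Implicit Arguments.
Unset Strict Implicit.
Unset Printing Implicit Defensive.
Import GRing.Theory Num.Theory.
Local Open Scope ring_scope.

(** Write [theta] for F + J. Since h (h [rho, X]) = h [rho, X], it equals
    [X |-> - h [rho, v X]]. Everything follows from the fact that [theta] and
    [J] are mutually inverse between the horizontal and the vertical fields: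
    J theta = v ([J_theta]) and theta J = h ([theta_J]). Together with h J = 0,
    J v = 0, v theta = 0 and theta h = 0, these identities make the two sides
    of each of Dh = 0, Dv = 0, DJ = 0 and D theta = 0 reduce to the same two
    terms; DF = 0 is the difference D theta - DJ.

    The identity J theta = v says that J [rho, V] = - V for every vertical V
    ([vertical_regular]), whereas regularity gives this only for V = J Y, and
    the hypothesis on the image of J is pointwise: V agrees with some J Y at
    each point, with Y depending on the point. The map V |-> J [rho, V] + V is
    linear over smooth functions on the vertical fields (the derivative
    term rho(f) V is killed by J), so it vanishes at e as soon as c V = J Y
    holds globally for one smooth c with c(e) != 0. Cramer's rule produces such
    a relation without bump functions or local frames: if J X_1, ..., J X_n
    span the vertical space at e, choose smooth functions phi_1, ..., phi_n
    with det (J X_i (phi_j)) != 0 at e. For every f, the determinant of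
    size n+1 that evaluates V, J X_1, ..., J X_n on f, phi_1, ..., phi_n is
    zero at every point, because the vertical spaces have dimension at most n.
    Its cofactors along the column of f do not depend on f, so they are the
    coefficients of a relation between V, J X_1, ..., J X_n, and that of V is
    nonzero at e ([vertical_relation]). *)

(** * Bordered determinants of functionals *)

Section BorderedDeterminant.

Definition evalmx (S : comPzRingType) (T : Type) (n : nat)
    (l : 'I_n -> T -> S) (t : 'I_n -> T) : 'M[S]_n :=
  \matrix_(i, j) l i (t j).

Definition fcons (T : Type) (n : nat) (x : T) (t : 'I_n -> T) : 'I_n.+1 -> T :=
  fun j => oapp t x (unlift ord0 j).

(** The cofactors of [evalmx l (fcons x t)] along its first column, in a form
    that does not mention [x]. *)
Definition border (S : comPzRingType) (T : Type) (n : nat)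
    (l : 'I_n.+1 -> T -> S) (t : 'I_n -> T) (i : 'I_n.+1) : S :=
  (-1) ^+ i * \det (evalmx (l \o lift i) t).

Lemma border_expand (S : comPzRingType) (T : Type) (n : nat)
    (l : 'I_n.+1 -> T -> S) (t : 'I_n -> T) (x : T) :
  \sum_i border l t i * l i x = \det (evalmx l (fcons x t)).
Proof.
rewrite (expand_det_col _ ord0); apply: eq_bigr => i _.
rewrite mxE /fcons unlift_none /= mulrC /border /cofactor addn0.
congr (_ * (_ * \det _)); apply/matrixP => a b.
by rewrite !mxE liftK.
Qed.

Lemma border0 (S : comPzRingType) (T : Type) (n : nat)
    (l : 'I_n.+1 -> T -> S) (t : 'I_n -> T) :
  border l t ord0 = \det (evalmx (l \o lift ord0) t).
Proof. by rewrite /border expr0 mul1r. Qed.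

(** By induction, the last [n] functions are separated by some [t]. If adding
    any further point [x] gave a zero determinant, expanding it along [x] would
    be a relation between the [l i] in which [l ord0] has a nonzero
    coefficient. *)
Lemma independent_evalmx (F : fieldType) (T : Type) (n : nat)
    (l : 'I_n -> T -> F) :
  (forall c : 'I_n -> F,
     (forall x, \sum_i c i * l i x = 0) -> forall i, c i = 0) ->
  exists t, \det (evalmx l t) != 0.
Proof.
elim: n l => [|n IH] l free_l.
  have t : 'I_0 -> T by case.
  by exists t; rewrite det_mx00 oner_neq0.
have [|t t_neq0] := IH (l \o lift ord0).
  move=> c c0 i; have := free_l (fcons 0 c) _ (lift ord0 i).
  rewrite /fcons liftK; apply=> x; rewrite big_ord_recl unlift_none mul0r add0r.
  by rewrite -[RHS](c0 x); apply: eq_bigr => j _; rewrite liftK.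
apply: contrapT => /forallNP all0; case/eqP: t_neq0; rewrite -border0.
apply: free_l => x; rewrite border_expand.
by apply/eqP/negP => neq0; apply: (all0 (fcons x t)); apply/negP.
Qed.

(** The matrix factors through a space of dimension [n], so its rank is at
    most [n]. *)
Lemma det_evalmx_span (F : fieldType) (T : Type) (n : nat)
    (l : 'I_n.+1 -> T -> F) (u : 'I_n -> T -> F) (C : 'I_n.+1 -> 'I_n -> F)
    (t : 'I_n.+1 -> T) :
  (forall i x, l i x = \sum_k C i k * u k x) -> \det (evalmx l t) = 0.
Proof.
move=> lE; apply/eqP; apply: contraT; rewrite -unitfE -/(_ \in unitmx) => lU.
have := mulmx_max_rank (\matrix_(i, k) C i k) (\matrix_(k, j) u k (t j)).
rewrite (_ : _ *m _ = evalmx l t) ?mxrank_unit ?ltnn //.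
by apply/matrixP => i j; rewrite !mxE lE; apply: eq_bigr => k _; rewrite !mxE.
Qed.

End BorderedDeterminant.

(** * Vector fields and the Lie bracket *)

Section VectorFields.
Context {R : realType} {n : nat} {M : manifold R n}.
Implicit Types (X Y Z V : vfield M) (f g : smooth_fun M).
Implicit Types (e : @slit_cotangent R n M).

Definition feval e : smooth_fun M -> R := fun f => f e.

Lemma feval_zmod_morphism e : zmod_morphism (feval e).
Proof. by []. Qed.

Lemma feval_monoid_morphism e : monoid_morphism (feval e).
Proof. by []. Qed.

HB.instance Definition _ e :=
  GRing.isZmodMorphism.Build _ _ (feval e) (feval_zmod_morphism e).
HB.instance Definition _ e :=
  GRing.isMonoidMorphism.Build _ _ (feval e) (feval_monoid_morphism e).

Lemma smooth_funP f g : (forall e, f e = g e) -> f = g.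
Proof. by move=> fg; apply/val_inj/funext. Qed.

Lemma vfieldP X Y : (forall f, X f = Y f) -> X = Y.
Proof. by move=> XY; apply/val_inj/funext. Qed.

Lemma tval_eq0P X : (forall e, Defs.tval X e = 0) -> X = 0.
Proof.
move=> X0; apply: vfieldP => f; apply: smooth_funP => e.
exact: (congr1 (@^~ f) (X0 e)).
Qed.

Lemma vact_sum (I : Type) (r : seq I) (W : I -> vfield M) f :
  (\sum_(i <- r) W i) f = \sum_(i <- r) W i f.
Proof. by elim/big_rec2: _ => // i Y g _ <-. Qed.

Lemma vactM X f g : X (f * g) = X f * g + f * X g.
Proof. by case: X => X /= /asboolP[]. Qed.

Lemma vactD X f g : X (f + g) = X f + X g.
Proof. by case: X => X /= /asboolP[linX _]; rewrite -[f]scale1r linX !scale1r. Qed.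

Lemma lieDr X Y Z : lie X (Y + Z) = lie X Y + lie X Z.
Proof.
apply: vfieldP => f.
rewrite [LHS](_ : _ = X (Y f + Z f) - (Y (X f) + Z (X f))) // vactD.
by rewrite opprD addrACA.
Qed.

Lemma lie0r X : lie X 0 = 0.
Proof. by apply: (addIr (lie X 0)); rewrite -lieDr !add0r. Qed.

Lemma lieBr X Y Z : lie X (Y - Z) = lie X Y - lie X Z.
Proof. by apply/eqP; rewrite eq_sym subr_eq -lieDr subrK. Qed.

Lemma lieZr X f Y : lie X (f *: Y) = X f *: Y + f *: lie X Y.
Proof.
apply: vfieldP => g.
rewrite [LHS](_ : _ = X (f * Y g) - f * Y (X g)) // vactM.
rewrite [RHS](_ : _ = X f * Y g + f * (X (Y g) - Y (X g))) //; ring.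
Qed.

Lemma scale_eq0_pointwise V :
  (forall e, exists f, f e != 0 /\ f *: V = 0) -> V = 0.
Proof.
move=> H; apply: vfieldP => g; apply: smooth_funP => e.
have [f [fe /(congr1 (fun X : vfield M => X g e)) fV]] := H e.
have {fV} : f e * V g e = 0 by [].
by move/eqP; rewrite mulf_eq0 (negbTE fe) => /eqP.
Qed.

(** * Vertical fields *)

(** Cramer's rule with smooth coefficients. The relation holds everywhere,
    even where the last [n] fields become dependent, because at each point all
    [n.+1] values lie in the span of the [n] coordinate vectors d/dp_i. *)
Lemma vertical_relation (W : 'I_n.+1 -> vfield M) e :
  (forall i e', vertical_at (W i) e') ->
  (forall c : 'I_n -> R,
     \sum_i c i *: Defs.tval (W (lift ord0 i)) e = 0 -> forall i, c i = 0) ->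
  exists c : 'I_n.+1 -> smooth_fun M,
    c ord0 e != 0 /\ \sum_i c i *: W i = 0.
Proof.
move=> vertW freeW.
pose l e' i : smooth_fun M -> R := Defs.tval (W i) e'.
have [|t t_neq0] := @independent_evalmx _ _ _ (l e \o lift ord0).
  move=> c c0; apply: freeW; apply/funext => f; rewrite -[RHS](c0 f).
  by rewrite fct_sumE.
have evalE e' k (w : 'I_k -> vfield M) s :
    \det (evalmx (fun i => Defs.tval (w i) e') s) =
    feval e' (\det (evalmx w s)).
  by rewrite -det_map_mx; congr (\det _); apply/matrixP => i j; rewrite !mxE.
exists (border W t); split.
  by rewrite border0; move: t_neq0; rewrite evalE.
apply: vfieldP => f; rewrite vact_sum.
rewrite [LHS](_ : _ = \sum_i border W t i * W i f) // border_expand.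
apply: smooth_funP => e'; rewrite -[LHS]/(feval e' _) -evalE.
have [a ae'] := chart_cover (base e').
pose C i := projT1 (cid (vertW i e' a ae')).
apply: (@det_evalmx_span _ _ _ _ (ddp a e') C) => i g.
by rewrite /C; case: cid => c /= ->; rewrite fct_sumE.
Qed.

Context (J : tensor11 M) (rho : vfield M).
Context (hJ : adapted_almost_tangent J) (hrho : regular_vfield J rho).

Lemma vertical_kerJ V : (forall e, vertical_at V e) <-> J V = 0.
Proof.
case: hJ => _ _ _ kerJ; split=> [vertV|JV e]; last by apply/kerJ; rewrite JV.
by apply: tval_eq0P => e; apply/kerJ.
Qed.

Lemma JJ X : J (J X) = 0.
Proof. by case: hJ. Qed.

(** Extends regularity from the fields [J X] to all vertical fields. Near any
    [e], a nonzero multiple [c ord0 *: V] is in the image of [J], and by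
    [J V = 0] the factor [c ord0] comes out of [J (lie rho _)]. *)
Lemma vertical_regular V : J V = 0 -> J (lie rho V) = - V.
Proof.
case: hJ => rankJ _ imJ _ JV.
apply/eqP; rewrite -addr_eq0; apply/eqP/scale_eq0_pointwise => e.
have [X [freeX _]] := rankJ e.
pose W := fcons V (fun i => J (X i)).
have W0 : W ord0 = V by rewrite /W /fcons unlift_none.
have WS i : W (lift ord0 i) = J (X i) by rewrite /W /fcons liftK.
have [i e'|c c0|c [ce cW]] := @vertical_relation W e.
- rewrite /W /fcons; case: unlift => [j|] /=; last by move: e'; apply/vertical_kerJ.
  by apply/imJ; exists (X j).
- by apply: freeX; rewrite -[RHS]c0; apply: eq_bigr => i _; rewrite WS.
exists (c ord0); split => //.
pose Y := - \sum_i c (lift ord0 i) *: X i.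
have cV : c ord0 *: V = J Y.
  rewrite /Y linearN linear_sum /=; apply/eqP.
  rewrite -addr_eq0 -[X in _ == X]cW big_ord_recl W0; apply/eqP.
  by congr (_ + _); apply: eq_bigr => i _; rewrite linearZ WS.
have : J (lie rho (c ord0 *: V)) = - (c ord0 *: V) by rewrite cV hrho.
rewrite lieZr linearD !linearZ /= JV scaler0 add0r => cJ.
by rewrite scalerDr cJ scalerN addNr.
Qed.

(** * Horizontal and vertical projectors *)

Context (N : tensor11 M) (hN : nonlinear_connection N).

Local Notation h := (hproj N).
Local Notation v := (vproj N).

Lemma hproj_linear : linear h.
Proof.
move=> f X Y; rewrite /hproj linearP scalerA [f * _]mulrC -scalerA -scalerDr.
by rewrite addrACA -[f *: X + _]scalerDr.
Qed.

Lemma vproj_linear : linear v.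
Proof.
move=> f X Y; rewrite /vproj linearP scalerA [f * _]mulrC -scalerA -scalerDr.
by rewrite opprD addrACA -[f *: X - _]scalerBr.
Qed.

HB.instance Definition _ := GRing.isLinear.Build _ _ _ _ h hproj_linear.
HB.instance Definition _ := GRing.isLinear.Build _ _ _ _ v vproj_linear.

Lemma hprojD X Y : h (X + Y) = h X + h Y.
Proof. exact: (linearD h). Qed.

Lemma vprojD X Y : v (X + Y) = v X + v Y.
Proof. exact: (linearD v). Qed.

Lemma hprojB X Y : h (X - Y) = h X - h Y.
Proof. exact: (linearB h). Qed.

Lemma vprojB X Y : v (X - Y) = v X - v Y.
Proof. exact: (linearB v). Qed.

Lemma hproj0 : h 0 = 0.
Proof. exact: (linear0 h). Qed.

Lemma vproj0 : v 0 = 0.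
Proof. exact: (linear0 v). Qed.

Lemma one_half_double X : one_half M *: (X + X) = X.
Proof.
apply: vfieldP => f; apply: smooth_funP => e.
rewrite [LHS](_ : _ = 2^-1 * 1 * (X f e + X f e)) //.
by rewrite mulr1 mulrC mulrDl -splitr.
Qed.

Lemma vprojE X : v X = X - h X.
Proof.
apply/eqP; rewrite eq_sym subr_eq /hproj /vproj -scalerDr.
by rewrite addrACA addNr addr0 one_half_double.
Qed.

Lemma N_vproj X : N (v X) = - v X.
Proof.
case: hN => NN _.
by rewrite /vproj linearZ [N (_ - _)]linearB /= NN -scalerN opprB.
Qed.

Lemma vproj_vertical X e : vertical_at (v X) e.
Proof.
by case: hN => _ /(_ (v X) e)[kerV _]; apply: kerV; rewrite N_vproj subrr.
Qed.

Lemma vertical_hproj V : (forall e, vertical_at V e) -> h V = 0.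
Proof.
case: hN => _ kerN vertV; rewrite /hproj (_ : V + N V = 0) ?scaler0 //.
by apply: tval_eq0P => e; apply/kerN.
Qed.

Lemma hprojV X : h (v X) = 0.
Proof. exact/vertical_hproj/vproj_vertical. Qed.

Lemma hprojK X : h (h X) = h X.
Proof. by apply/esym/eqP; rewrite -subr_eq0 -hprojB -vprojE hprojV. Qed.

Lemma vprojH X : v (h X) = 0.
Proof. by rewrite vprojE hprojK subrr. Qed.

Lemma vprojK X : v (v X) = v X.
Proof. by rewrite vprojE hprojV subr0. Qed.

Lemma hprojJ X : h (J X) = 0.
Proof. by apply/vertical_hproj/vertical_kerJ; rewrite JJ. Qed.

Lemma vprojJ X : v (J X) = J X.
Proof. by rewrite vprojE hprojJ subr0. Qed.

Lemma Jvproj X : J (v X) = 0.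
Proof. exact/vertical_kerJ/vproj_vertical. Qed.

Lemma Jhproj X : J (h X) = J X.
Proof. by apply/esym/eqP; rewrite -subr_eq0 -linearB /= -vprojE Jvproj. Qed.

(** * The tensor F + J *)

(** This is F + J, by [FF_theta]; in this form J no longer appears. *)
Definition theta X : vfield M := - h (lie rho (v X)).

Lemma theta0 : theta 0 = 0.
Proof. by rewrite /theta vproj0 lie0r hproj0 oppr0. Qed.

Lemma thetaD X Y : theta (X + Y) = theta X + theta Y.
Proof. by rewrite /theta vprojD lieDr hprojD opprD. Qed.

Lemma thetaB X Y : theta (X - Y) = theta X - theta Y.
Proof. by rewrite /theta vprojB lieBr hprojB opprD. Qed.

Lemma FF_theta X : FF J rho N X + J X = theta X.
Proof.
rewrite /FF subrK /lie_tensor hprojB hprojK /theta -hprojB -(linearN h) /=.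
by rewrite vprojE lieBr opprB.
Qed.

Lemma hproj_theta X : h (theta X) = theta X.
Proof. by rewrite /theta [h (- _)]linearN /= hprojK. Qed.

Lemma vproj_theta X : v (theta X) = 0.
Proof. by rewrite -hproj_theta vprojH. Qed.

Lemma theta_vproj X : theta (v X) = theta X.
Proof. by rewrite /theta vprojK. Qed.

Lemma theta_hproj X : theta (h X) = 0.
Proof. by rewrite /theta vprojH lie0r hproj0 oppr0. Qed.

Lemma theta_theta X : theta (theta X) = 0.
Proof. by rewrite -(hproj_theta X) theta_hproj. Qed.

Lemma J_theta X : J (theta X) = v X.
Proof.
by rewrite [J (- _)]linearN /= Jhproj vertical_regular ?opprK ?Jvproj.
Qed.

(** The difference of the two sides is horizontal, and it is vertical because
    [J] kills it by [J_theta]. *)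
Lemma theta_J X : theta (J X) = h X.
Proof.
apply/eqP; rewrite -subr_eq0 -hproj_theta -[X in _ - X]hprojK -hprojB.
apply/eqP/vertical_hproj/vertical_kerJ.
by rewrite [J _]linearB /= J_theta vprojJ Jhproj subrr.
Qed.

(** * The Berwald connection *)

Local Notation D := (berwald J rho N).

Lemma berwaldE X Y :
  D X Y = v (lie (h X) (v Y)) + h (lie (v X) (h Y))
          + J (lie (v X) (theta Y)) + theta (lie (h X) (J Y)).
Proof. by rewrite -(FF_theta Y) -(FF_theta (lie _ _)). Qed.

Lemma berwaldBr X Y Z : D X (Y - Z) = D X Y - D X Z.
Proof.
rewrite !berwaldE hprojB vprojB thetaB (linearB J) /= !lieBr.
by rewrite hprojB vprojB thetaB (linearB J) /= 3![in RHS]opprD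
  [RHS]addrACA [X in _ = X + _]addrACA [X in _ = X + _ + _]addrACA.
Qed.

Lemma parallel_hproj : parallel D h.
Proof.
move=> X Y; rewrite !berwaldE !hprojD vprojH hprojK theta_hproj Jhproj.
rewrite !lie0r vproj0 (linear0 J) hprojV hprojK hprojJ hproj_theta.
by rewrite !add0r !addr0.
Qed.

Lemma parallel_vproj : parallel D v.
Proof.
move=> X Y; rewrite !berwaldE !vprojD hprojV vprojK theta_vproj Jvproj.
rewrite !lie0r hproj0 theta0 vprojK vprojH vprojJ vproj_theta.
by rewrite !addr0.
Qed.

Lemma parallel_J : parallel D J.
Proof.
move=> X Y; rewrite !berwaldE !(linearD J) hprojJ vprojJ theta_J JJ.
rewrite !lie0r hproj0 theta0 Jvproj JJ Jhproj J_theta.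
by rewrite !addr0 add0r addrC.
Qed.

Lemma parallel_theta : parallel D theta.
Proof.
move=> X Y; rewrite !berwaldE !thetaD hproj_theta vproj_theta theta_theta.
rewrite J_theta !lie0r vproj0 (linear0 J).
rewrite theta_vproj theta_hproj theta_J theta_theta.
by rewrite add0r !addr0 addrC.
Qed.

Lemma parallel_FF : parallel D (FF J rho N).
Proof.
have FE Z : FF J rho N Z = theta Z - J Z by rewrite -FF_theta addrK.
by move=> X Y; rewrite !FE berwaldBr parallel_theta parallel_J.
Qed.

End VectorFields.

Theorem proposition1 (R : realType) (n : nat) (M : manifold R n)
    (J : tensor11 M) (rho : vfield M) (N : tensor11 M)
    (hJ : adapted_almost_tangent J) (hrho : regular_vfield J rho)
    (hN : nonlinear_connection N) :
  [/\ parallel (berwald J rho N) (hproj N),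
      parallel (berwald J rho N) (vproj N),
      parallel (berwald J rho N) J &
      parallel (berwald J rho N) (FF J rho N)].
Proof.
split; [exact: parallel_hproj|exact: parallel_vproj|exact: parallel_J|].
exact: parallel_FF.
Qed.
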